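(* The connectivity problem for unary automatic graphs of finite degree is solvable in time $O(p^3)$: there is an algorithm which, given a (standard one-loop) automaton with loop constant $p$ recognizing the edge relation of a unary automatic graph of finite degree $\mathcal{G}$, decides in time $O(p^3)$ whether $\mathcal{G}$ is connected.
   Context: Let $\diamond$ be a symbol different from $1$. The convolution $\otimes(1^m,1^n)$ is the word of length $\max(m,n)$ over $\{1,\diamond\}^2$ whose $k$-th letter is $(a,b)$, where $a=1$ if $k\le m$ and $a=\diamond$ otherwise, and $b=1$ if $k\le n$ and $b=\diamond$ otherwise. An automaton (always a deterministic finite automaton) recognizes a binary relation $E\subseteq 1^\star\times 1^\star$ if it accepts exactly the convolutions of the pairs in $E$. A unary automatic graph is a graph $\mathcal{G}=(V,E)$ with $V=1^\star$ and $E$ recognized by some automaton. Graphs are undirected ($E$ is symmetric). A graph is of finite degree if there are only finitely many edges from each vertex. A graph is connected if there is a path between any pair of vertices. In an automaton recognizing a binary relation over $1^\star$, the $(1,1)$-states are the states reachable from the initial state by reading letters $(1,1)$; they form a disjoint union of a tail (a sequence of states linked by transitions without repetition) and a loop (a cycle), called the $(1,1)$-tail and $(1,1)$-loop. For a $(1,1)$-state $s$, the states reachable from $s$ by reading letters $(1,\diamond)$ (resp. $(\diamond,1)$) likewise form $(1,\diamond)$-tails and loops (resp. $(\diamond,1)$-tails and loops). A one-loop automaton is one whose transition diagram contains exactly one loop, the $(1,1)$-loop. It is standard with loop constant $p$ if its loop and all its tails have length $p$; thus it has $p$ states on the $(1,1)$-tail, $p$ states on the $(1,1)$-loop, and from each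 of these $2p$ states a $(1,\diamond)$-tail and a $(\diamond,1)$-tail of length $p$. A unary automatic graph of finite degree is always given by a standard one-loop automaton recognizing its edge relation. *)

(* Defs.v *)
From mathcomp Require Import all_boot.

Set Implicit Arguments.
Unset Strict Implicit.
Unset Printing Implicit Defensive.

(** * Words, convolutions and automata *)

(* [true] stands for the symbol 1 and [false] for the padding symbol. *)
Definition letter : Type := (bool * bool)%type.

Definition one_one : letter := (true, true).
Definition one_dia : letter := (true, false).
Definition dia_one : letter := (false, true).
Definition dia_dia : letter := (false, false).

(* The word 1^n is identified with n, so the vertex set 1^* is [nat].
   Positions are numbered from 0. *)
Definition conv (m n : nat) : seq letter :=
  [seq (k < m, k < n) | k <- iota 0 (maxn m n)].

(* The transition function is partial: a total one would need a rejecting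
   sink, whose self-loops would be additional loops of the diagram. *)
Record dfa := Dfa {
  nstates : nat;
  init : 'I_nstates;
  delta : 'I_nstates -> letter -> option 'I_nstates;
  final : pred 'I_nstates
}.

Notation state A := 'I_(nstates A).

Fixpoint run (A : dfa) (s : state A) (w : seq letter) : option (state A) :=
  if w is a :: w' then
    if delta s a is Some t then run t w' else None
  else Some s.

Definition accepts (A : dfa) (w : seq letter) : bool :=
  if run (init A) w is Some s then final s else false.

Definition recognizes (A : dfa) (E : rel nat) : Prop :=
  forall w, accepts A w <-> exists m n, E m n /\ w = conv m n.

(** * Standard one-loop automata *)

Definition trans (A : dfa) (a : letter) : rel (state A) :=
  fun s t => delta s a == Some t.

(* The states reached from [s] (included) by reading the letter [a]
   repeatedly are, in this order, those of [tl] and then those of the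
   cycle [lp]. *)
Definition tail_loop (A : dfa) (a : letter) (s : state A)
    (tl lp : seq (state A)) : Prop :=
  [/\ ohead (tl ++ lp) = Some s, uniq (tl ++ lp),
      sorted (trans a) (tl ++ lp), lp != [::] & cycle (trans a) lp].

(* The states reached from [s] (excluded) by reading the letter [a]
   repeatedly are, in this order, those of [l]. *)
Definition tail (A : dfa) (a : letter) (s : state A)
    (l : seq (state A)) : Prop :=
  [/\ uniq l, path (trans a) s l & delta (last s l) a = None].

(* [tl] and [lp] are the (1,1)-tail and the (1,1)-loop, and every closed walk
   in the transition diagram of [A] goes round [lp]. *)
Definition one_loop (A : dfa) (tl lp : seq (state A)) : Prop :=
  tail_loop one_one (init A) tl lp /\
  forall (s : state A) (w : seq letter), w != [::] -> run s w = Some s ->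
    s \in lp /\ all (pred1 one_one) w.

Definition standard_one_loop (A : dfa) (p : nat) : Prop :=
  exists tl lp : seq (state A),
    [/\ one_loop tl lp, size tl = p, size lp = p &
        forall (s : state A) (a : letter),
          s \in tl ++ lp -> a \in [:: one_dia; dia_one] ->
          exists l, tail a s l /\ size l = p].

(** * Graphs on [nat] *)

Definition finite_degree (E : rel nat) : Prop :=
  forall x, exists s : seq nat, forall y, E x y -> y \in s.

Definition graph_connected (E : rel nat) : Prop :=
  forall x y, exists s : seq nat, path E x s /\ last x s = y.

(** * Random access machines with unit cost *)

(* Load-store random access machine without multiplication. Registers are
   named by the program; memory cells are addressed by register contents. *)
Inductive instr :=
| IConst (r c : nat)      (* R[r] := c *)
| IAdd (r i j : nat)     (* R[r] := R[i] + R[j] *)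
| ISub (r i j : nat)     (* R[r] := R[i] - R[j], truncated at 0 *)
| ILoad (r i : nat)      (* R[r] := M[R[i]] *)
| IStore (i j : nat)     (* M[R[i]] := R[j] *)
| IJz (r l : nat).       (* if R[r] = 0 then continue at instruction l *)

Definition program := seq instr.

Record config := Config { pc : nat; reg : nat -> nat; mem : nat -> nat }.

Definition upd (f : nat -> nat) (x v : nat) : nat -> nat :=
  fun y => if y == x then v else f y.

Definition exec (i : instr) (c : config) : config :=
  let: Config k R M := c in
  match i with
  | IConst r v => Config k.+1 (upd R r v) M
  | IAdd r x y => Config k.+1 (upd R r (R x + R y)) M
  | ISub r x y => Config k.+1 (upd R r (R x - R y)) M
  | ILoad r x => Config k.+1 (upd R r (M (R x))) M
  | IStore x y => Config k.+1 R (upd M (R x) (R y))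
  | IJz r l => Config (if R r == 0 then l else k.+1) R M
  end.

Definition step (P : program) (c : config) : config :=
  if onth P (pc c) is Some i then exec i c else c.

Definition halted (P : program) (c : config) : bool := size P <= pc c.

Definition start (input : seq nat) : config :=
  Config 0 (fun=> 0) (nth 0 input).

(* The answer is left in register 0: 1 for yes, 0 for no. *)
Definition decides_within (P : program) (input : seq nat) (T : nat)
    (Q : Prop) : Prop :=
  exists t : nat, let c := iter t (step P) (start input) in
    [/\ t <= T, halted P c & exists b : bool, reg c 0 = b /\ (b <-> Q)].

(* Transition table: an undefined transition is coded by 0, and a transition
   to the state numbered t by t + 1. The loop constant is not part of the
   input. *)
Definition encode_state (A : dfa) (s : state A) : seq nat :=
  let target a := if delta s a is Some t then (t : nat).+1 else 0 in
  [:: target one_one; target one_dia; target dia_one; target dia_dia;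
      nat_of_bool (final s)].

Definition encode (A : dfa) : seq nat :=
  nstates A :: (init A : nat) ::
  flatten [seq encode_state s | s <- enum 'I_(nstates A)].

(* Main.v *)
Require Import Defs.
From mathcomp Require Import all_boot zify.

Set Implicit Arguments.
Unset Strict Implicit.
Unset Printing Implicit Defensive.

(* Let N = p (p + 2). Edges have length at most p, and the graph is invariant
   under translation by p from p on. The connectivity relation which the
   subgraph induced on [p, p + k p) defines on [p, 2p) is therefore a function
   of the one for k - 1; it becomes coarser as k grows, so it is constant from
   k = p on. Hence a walk between vertices below 3p can be rerouted inside
   [0, N). Moreover, if every vertex of [2p, 3p) is joined to 0, then it is
   joined to [p, 2p) above p, so by translation every vertex from 2p on is
   joined to a smaller one. So the graph is connected if and only if all x < 3p
   are reached from 0 inside [0, N). There are O(p^2) vertices of degree O(p),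
   so a breadth-first search takes time O(p^3); the loop constant is the
   length of the (dia,1)-tail of the initial state. *)

(** * Graphs that are eventually periodic *)

(** Inductive rather than a [connect], because [D] may be infinite. Steps are added at the end, so
    that inductions carry an invariant on the current vertex. *)
Inductive reach (E : rel nat) (D : pred nat) (x : nat) : nat -> Prop :=
| reach_refl : D x -> reach E D x x
| reach_step y z : reach E D x y -> E y z -> D z -> reach E D x z.

Definition itv (a b : nat) : pred nat := fun x => a <= x < b.

Section Reach.
Variable E : rel nat.

Lemma reach_dom D x y : reach E D x y -> D x /\ D y.
Proof. by elim=> // y' z _ [Dx _] _ Dz. Qed.

Lemma reach_sub (D D' : pred nat) x y :
  {subset D <= D'} -> reach E D x y -> reach E D' x y.
Proof.
move=> sDD'; elim=> [Dx|y' z _ IH Eyz Dz]; first by apply/reach_refl/sDD'.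
by apply: reach_step IH Eyz _; apply: sDD'.
Qed.

Lemma reach_trans D x y z : reach E D x y -> reach E D y z -> reach E D x z.
Proof.
by move=> xy; elim=> // y' z' _ IH Eyz Dz; apply: reach_step IH Eyz Dz.
Qed.

Hypothesis symE : symmetric E.

Lemma reach_sym D x y : reach E D x y -> reach E D y x.
Proof.
elim=> [Dx|y' z xy IH Eyz Dz]; first exact: reach_refl.
have [_ Dy] := reach_dom xy.
apply: reach_trans IH; apply: reach_step Dy; first exact: reach_refl.
by rewrite symE.
Qed.

Lemma connectedP : graph_connected E <-> forall x, reach E predT 0 x.
Proof.
split=> [cE x|cE x y].
  have [s [Es <-]] := cE 0 x; elim/last_ind: s Es => [|s z IH].
    by move=> _; apply: reach_refl.
  rewrite rcons_path last_rcons => /andP[/IH xs Ez].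
  exact: reach_step xs Ez _.
have: reach E predT x y by apply: reach_trans (cE y); apply: reach_sym.
elim=> [_|y' z _ [s [Es Els]] Eyz _]; first by exists [::].
by exists (rcons s z); rewrite rcons_path Es last_rcons Els.
Qed.

(** Makes reachability inside a bounded interval decidable. The type ['I_b] carries the upper bound;
    the lower one is tested on targets only, the source being covered by [a <= x]. *)
Lemma reachP a b (x y : 'I_b) : a <= x ->
  reflect (reach E (itv a b) x y)
    (connect (fun u v : 'I_b => (a <= v) && E u v) x y).
Proof.
move=> ax; apply: (iffP idP) => [/connectP[s]|].
  elim/last_ind: s y => [y _ ->|s z IH y].
    by apply: reach_refl; rewrite /itv ax ltn_ord.
  rewrite rcons_path last_rcons => /andP[es /andP[az Ez]] ->.
  by apply: reach_step (IH _ es erefl) Ez _; rewrite /itv az ltn_ord.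
suff gen z : reach E (itv a b) x z -> forall y : 'I_b, z = y ->
    connect (fun u v : 'I_b => (a <= v) && E u v) x y by move=> /gen; apply.
elim=> [_ {}y /val_inj->|y' z' xy IH Eyz /andP[az zb] {}y yz].
  exact: connect0.
have [_ /andP[_ yb]] := reach_dom xy.
apply: connect_trans (IH (Ordinal yb) erefl) (connect1 _).
by rewrite /= -yz az.
Qed.

Lemma reach_finite a x y :
  reach E (fun z => a <= z) x y -> exists b, reach E (itv a b) x y.
Proof.
elim=> [ax|y' z _ [b IH] Eyz az].
  by exists x.+1; apply: reach_refl; rewrite /itv ax /=.
exists (maxn b z.+1).
apply: reach_step Eyz _; last by rewrite /itv az leq_maxr.
apply: reach_sub IH => u; rewrite !unfold_in /itv; lia.
Qed.

(** * Translations and excursions of walks *)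

Variable p : nat.
Hypothesis lenE : forall m n, E m n -> n <= m + p.
Hypothesis perE : forall m n, p <= m -> p <= n -> E (m + p) (n + p) = E m n.

Lemma perEj j m n : p <= m -> p <= n -> E (m + j * p) (n + j * p) = E m n.
Proof.
move=> pm pn; elim: j => [|j IH]; first by rewrite !addn0.
by rewrite mulSn ![_ + (p + _)]addnCA ![p + _]addnC perE //; lia.
Qed.

Lemma reach_up j (D D' : pred nat) x y :
  (forall z, D z -> p <= z /\ D' (z + j * p)) ->
  reach E D x y -> reach E D' (x + j * p) (y + j * p).
Proof.
move=> DD'; elim=> [/DD'[_ Dx]|y' z xy IH Eyz /DD'[pz Dz]].
  exact: reach_refl.
have [_ /DD'[py _]] := reach_dom xy.
by apply: reach_step IH _ Dz; rewrite perEj.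
Qed.

Lemma reach_down (D D' : pred nat) x y :
  (forall z, D z -> p + p <= z /\ D' (z - p)) ->
  reach E D x y -> reach E D' (x - p) (y - p).
Proof.
move=> DD'; elim=> [/DD'[_ Dx]|y' z xy IH Eyz /DD'[pz Dz]].
  exact: reach_refl.
have [_ /DD'[py _]] := reach_dom xy.
apply: reach_step IH _ Dz; rewrite -perE; try lia.
by rewrite !subnK //; lia.
Qed.

(* Since edges have length at most [p], a walk enters and leaves [c, oo)
   through [c, c + p). *)
Lemma reach_cut (D D' : pred nat) c x z :
  (forall w y, itv c (c + p) w -> itv c (c + p) y ->
     reach E (fun u => D u && (c <= u)) w y -> reach E D' w y) ->
  (forall u, D u -> u < c + p -> D' u) ->
  x < c -> z < c + p -> reach E D x z -> reach E D' x z.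
Proof.
move=> H sD xc zcp xz.
(* Invariant on the end [z] of the walk: below [c] it is reached inside [D']; otherwise [w] is the
   vertex through which the current excursion into [[c, oo)] entered. *)
suff: (z < c -> reach E D' x z) /\ (c <= z -> exists w,
    [/\ itv c (c + p) w, reach E D' x w & reach E (fun u => D u && (c <= u)) w z]).
  case=> small big; have [/small//|/big[w [cw xw wz]]] := ltnP z c.
  apply: reach_trans xw (H _ _ cw _ wz).
  by have [_ /andP[_ cz]] := reach_dom wz; rewrite /itv cz zcp.
elim: xz {zcp} => [Dx|y z' xy [IH1 IH2] Eyz Dz].
  split=> [_|]; last by rewrite leqNgt xc.
  by apply: reach_refl; apply: sD => //; lia.
have [_ Dy] := reach_dom xy.
have lyz := lenE Eyz; have lzy: y <= z' + p by apply: lenE; rewrite symE.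
split=> cz; have [yc|cy] := ltnP y c.
- apply: reach_step (IH1 yc) Eyz _; apply: sD => //; lia.
(* The excursion ends here: [y] is less than [c + p], so [H] replaces the part from [w] to [y]. *)
- have [w [cw xw wy]] := IH2 cy.
  have wy': reach E D' w y by apply: H => //; rewrite /itv; lia.
  apply: reach_step (reach_trans xw wy') Eyz _; apply: sD => //; lia.
- exists z'; rewrite /itv; split; first by lia.
    apply: reach_step (IH1 yc) Eyz _; apply: sD => //; lia.
  by apply: reach_refl; rewrite Dz.
- have [w [cw xw wy]] := IH2 cy; exists w; split=> //.
  by apply: reach_step wy Eyz _; rewrite Dz.
Qed.

(** Together with [reach_itvS]: the intervals of [k] and of [k + 1] periods above [p] induce the
    same connectivity relation on [[p, 2p)]. *)
Definition stable k := forall x y, x < p + p -> y < p + p ->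
  reach E (itv p (p + k.+1 * p)) x y -> reach E (itv p (p + k * p)) x y.

(** Excursions above [2p] are translated down by [p], shortened by [stable k], and translated back.
    The bound [0 < k] leaves room for the window [[2p, 3p)]. *)
Lemma stable_next k : 0 < k -> stable k -> stable k.+1.
Proof.
move=> k0 st x y xp yp.
apply: (@reach_cut _ _ (p + p)) => //; last by lia.
  move=> w z /andP[cw wc] /andP[cz zc] wz.
  have {}wz: reach E (itv p (p + k.+1 * p)) (w - p) (z - p).
    apply: reach_down wz => u; rewrite /itv; lia.
  have {}wz := @reach_up 1 (itv p (p + k * p)) (itv p (p + k.+1 * p)) _ _ _
    (st _ _ _ _ wz).
  rewrite !mul1n !subnK in wz; try lia.
  apply: wz; try lia.
  by move=> u; rewrite /itv; lia.
move=> u; rewrite /itv; nia.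
Qed.

Lemma reach_itvS k x y : reach E (itv p (p + k * p)) x y ->
  reach E (itv p (p + k.+1 * p)) x y.
Proof. by apply: reach_sub => u; rewrite !unfold_in /itv; lia. Qed.

(* The components of [p, p + k p) meeting [p, 2p), counted by their least
   elements, decrease in number until they stabilise. *)
Lemma stable_exists : 0 < p -> exists k, 0 < k <= p /\ stable k.
Proof.
move=> p0.

(* [r k] is the connectivity relation translated down to [[0, p)], made boolean so that its classes
   can be counted. *)
have [r rP] : exists r : nat -> rel nat, forall k x y, 0 < k ->
    x < p -> y < p -> r k x y <-> reach E (itv p (p + k * p)) (p + x) (p + y).
  exists (fun k x y => connect
    (fun u v : 'I_(p + k * p).-1.+1 => (p <= v) && E u v)
    (inord (p + x)) (inord (p + y))).
  move=> k x y k0 xp yp; have kp: p <= k * p by rewrite leq_pmull.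
  have e: (p + k * p).-1.+1 = p + k * p by lia.
  have H z : z < p -> @inord (p + k * p).-1 (p + z) = p + z :> nat.
    by move=> zp; rewrite inordK //; lia.
  have gen b (u v : 'I_b) : b = p + k * p -> u = p + x :> nat -> v = p + y :> nat ->
      connect (fun u v : 'I_b => (p <= v) && E u v) u v <->
      reach E (itv p (p + k * p)) (p + x) (p + y).
    move=> <- ux <-; rewrite -ux; apply: iff_sym; apply: (rwP (reachP _ _)).
    by rewrite ux leq_addr.
  by apply: gen; rewrite ?H.
have {}rP k x y (k0 : 0 < k) (xp : x < p) (yp : y < p) := equivP idP (rP k x y k0 xp yp).
have r_refl k x : 0 < k -> x < p -> r k x x.
  move=> k0 xp; apply/rP => //; apply: reach_refl; rewrite /itv; nia.
have r_sym k x y : 0 < k -> x < p -> y < p -> r k x y -> r k y x.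
  by move=> k0 xp yp /rP H; apply/rP => //; apply/reach_sym/H.
have r_trans k x y z : 0 < k -> x < p -> y < p -> z < p -> r k x y -> r k y z -> r k x z.
  move=> k0 xp yp zp /rP H1 /rP H2; apply/rP => //.
  by apply: reach_trans (H1 _ _ _) (H2 _ _ _).
have r_S k x y : 0 < k -> x < p -> y < p -> r k x y -> r k.+1 x y.
  by move=> k0 xp yp /rP H; apply/rP => //; apply/reach_itvS/H.
pose mins k := [set x : 'I_p | [forall y : 'I_p, (y < x) ==> ~~ r k y x]].
have min_rep k (x : 'I_p) : 0 < k -> exists2 y, y \in mins k & r k y x.
  move=> k0; elim/ltn_ind: {x}(x : nat) {-2}x (erefl (x : nat)) => n IH x xn.
  case: (boolP (x \in mins k)) => [xm|]; first by exists x => //; apply: r_refl.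
  rewrite inE negb_forall => /existsP[y]; rewrite negb_imply negbK => /andP[yx ryx].
  have [|z zm rzy] := IH y _ y erefl; first by rewrite -xn.
  by exists z => //; apply: (@r_trans _ _ y).
have mins_sub k : 0 < k -> mins k.+1 \subset mins k.
  move=> k0; apply/subsetP => x; rewrite !inE => /forallP H; apply/forallP => y.
  by apply/implyP => yx; apply: contra (implyP (H y) yx); apply: r_S.
(* If every class minimum for [k] is still one for [k + 1], two minima related at [k + 1] are equal;
   hence points related at [k + 1] already had the same minimum at [k]. *)
have mins_stable k : 0 < k -> mins k \subset mins k.+1 -> stable k.
  move=> k0 /subsetP sub x y xp yp xy.
  have [/andP[px _] /andP[py _]] := reach_dom xy.
  have xp' : x - p < p by lia.
  have yp' : y - p < p by lia.
  have {xy} rxy : r k.+1 (x - p) (y - p) by apply/rP => //; rewrite !subnKC.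
  suff /rP H : r k (x - p) (y - p) by rewrite !subnKC // in H; apply: H.
  have [x' mx rx] := min_rep k (Ordinal xp') k0.
  have [y' my ry] := min_rep k (Ordinal yp') k0.
  have rxy' : r k.+1 x' y'.
    apply: (@r_trans _ _ (x - p)) => //; first exact: r_S.
    by apply: (@r_trans _ _ (y - p)) => //; apply/r_sym/r_S.
  have exy : x' = y'.
    move: (sub _ mx) (sub _ my); rewrite !inE => /forallP Hx /forallP Hy.
    apply/val_inj; case: (ltngtP x' y') => // lt.
      by have := implyP (Hy x') lt; rewrite rxy'.
    by have := implyP (Hx y') lt; rewrite r_sym.
  by rewrite exy in rx; apply: (@r_trans _ _ y') => //; apply: r_sym.
have mins_gt0 k : 0 < k -> 0 < #|mins k|.
  move=> k0; have [y ym _] := min_rep k (Ordinal p0) k0.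
  by apply/card_gt0P; exists y.
case: (boolP [exists k : 'I_p, mins k.+1 \subset mins k.+2]) => [/existsP[k Hk]|].
  by exists k.+1; split; [rewrite /= ltn_ord | apply: mins_stable].
rewrite negb_exists => /forallP H.
(* Strict inclusions at [1, ..., p] would bring the number of minima from at most [p] down to 0. *)
have dec j : j <= p -> #|mins j.+1| + j <= p.
  elim: j => [_|j IH jp]; first by rewrite addn0 -[X in _ <= X]card_ord max_card.
  have := IH (ltnW jp).
  have : #|mins j.+2| < #|mins j.+1|.
    by apply: proper_card; rewrite properE mins_sub //= (H (Ordinal jp)).
  by lia.
by have := dec p (leqnn p); have := mins_gt0 p.+1 isT; lia.
Qed.

(** A walk above [p] is finite, so it lies in [k + b] periods for some [b]; stability from [k] on
    removes these [b] periods one by one, and [k <= p]. *)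
Lemma stable_reach x y : 0 < p -> x < p + p -> y < p + p ->
  reach E (fun z => p <= z) x y -> reach E (itv p (p + p * p)) x y.
Proof.
move=> p0 xp yp /reach_finite[b xy].
have [k [/andP[k0 kp] stk]] := stable_exists p0.
have st j : stable (k + j).
  by elim: j => [|j IH]; rewrite ?addn0 // addnS; apply: stable_next => //; lia.
have {xy} : reach E (itv p (p + (k + b) * p)) x y.
  apply: reach_sub xy => u; rewrite !unfold_in /itv; nia.
elim: b => [|b IH] xy; last by apply: IH; apply: (st b) => //; rewrite -addnS.
apply: reach_sub xy => u; rewrite !unfold_in /itv addn0; nia.
Qed.

Lemma connected_bounded : 0 < p ->
  graph_connected E <->
  forall x, x < 3 * p -> reach E (itv 0 (p * (p + 2))) 0 x.
Proof.
move=> p0; split=> [/connectedP cE x xp|H].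
  (* An excursion above [2p], translated down, is rerouted inside [[p, p + p * p)]. Translated back,
     this interval ends at [2p + p * p], which is the bound [p * (p + 2)]. *)
  apply: (@reach_cut predT _ (p + p)) (cE x); try lia.
    move=> w y /andP[cw wc] /andP[cy yc] wy.
    have {}wy : reach E (fun z => p <= z) (w - p) (y - p).
      by apply: reach_down wy => u /=; lia.
    have {}wy := stable_reach p0 _ _ wy.
    have {}wy := @reach_up 1 _ (itv 0 (p * (p + 2))) _ _ _ (wy _ _).
    rewrite !mul1n !subnK in wy; try lia.
    by apply: wy; try lia; move=> u; rewrite /itv; nia.
  by move=> u _; rewrite /itv; nia.
(* The walk from [v] to 0 is followed until it first drops below [2p]; a step of length at most [p]
   cannot take it below [p]. *)
have back v : p + p <= v -> v < 3 * p ->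
    exists2 u, u < p + p & reach E (fun z => p <= z) v u.
  move=> pv vp; have v0 := reach_sym (H v vp).
  suff : (p + p <= 0 /\ reach E (leq (p + p)) v 0) \/
      (exists2 u, u < p + p & reach E (leq p) v u).
    by case=> [[]|//]; rewrite leqn0 addn_eq0 (gtn_eqF p0).
  elim: v0 => [_|y z vy [[py IH]|IH] Eyz Dz]; try by right.
    by left; split=> //; apply: reach_refl.
  have lyz: y <= z + p by apply: lenE; rewrite symE.
  have [zp|pz] := ltnP z (p + p); last first.
    by left; split=> //; apply: reach_step IH Eyz _.
  right; exists z => //; apply: (reach_step _ Eyz); last by lia.
  by apply: reach_sub IH => u; rewrite !unfold_in /=; lia.
apply/connectedP; elim/ltn_ind => z IH.
have [zp|pz] := ltnP z (3 * p).
  by apply: reach_sub (H z zp) => u.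
(* [z] is the translate by [j * p] of [v] in [[2p, 3p)]; [back] then joins [z] to [u + j * p], which
   is smaller than [z]. *)
pose j := z %/ p - 2; pose v := z - j * p.
have zjp : z = v + j * p by rewrite /v /j; have := leq_divM z p; nia.
have [pv vp] : p + p <= v /\ v < 3 * p.
  have := divn_eq z p; have := ltn_pmod z p0.
  have : 3 <= z %/ p by rewrite leq_divRL.
  by rewrite /v /j; nia.
have [u up vu] := back v pv vp.
have zu : reach E predT z (u + j * p).
  by rewrite zjp; apply: reach_up vu.
apply: reach_trans (reach_sym zu).
by apply: IH; rewrite zjp; lia.
Qed.

End Reach.

(** * Edges of a standard one-loop automaton *)

Lemma nth_flatten_const (T : Type) (x0 : T) k (ss : seq (seq T)) i j :
  all (fun s => size s == k) ss -> j < k -> 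
  nth x0 (flatten ss) (k * i + j) = nth x0 (nth [::] ss i) j.
Proof.
move=> + jk; elim: ss i => [|s ss IH] [|i] //=; rewrite ?nth_nil //.
  by move=> /andP[/eqP ss1 _]; rewrite muln0 nth_cat ss1 jk.
move=> /andP[/eqP ss1 /IH <-]; rewrite nth_cat ss1 ltnNge.
by rewrite mulnS -addnA leq_addr /= addKn.
Qed.

Lemma nth_cycle (T : Type) (e : rel T) (x0 : T) s i : cycle e s -> i < size s ->
  e (nth x0 s i) (nth x0 s (if i.+1 == size s then 0 else i.+1)).
Proof.
case: s => //= x s /(pathP x0)/(_ i); rewrite size_rcons => + ilt => /(_ ilt).
rewrite -rcons_cons nth_rcons /= ilt nth_rcons eqSS.
case: eqP => [->|ne]; rewrite ?ltnn ?eqxx // ifT //; lia.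
Qed.

Lemma conv_addn m d :
  conv m (m + d) = nseq m one_one ++ nseq d dia_one.
Proof.
apply: (@eq_from_nth _ dia_dia) => [|i].
  by rewrite size_map size_iota size_cat !size_nseq; lia.
rewrite size_map size_iota => ib.
rewrite (nth_map 0) ?size_iota // nth_iota // nth_cat size_nseq !nth_nseq.
rewrite add0n; have [im|mi] := ltnP i m; first by rewrite ltn_addr.
by rewrite ltn_subLR //; case: ifP => //; lia.
Qed.

(** Each number is recovered by counting the symbols 1 on its track. *)
Lemma conv_inj m n m' n' : conv m n = conv m' n' -> m = m' /\ n = n'.
Proof.
have c1 a b : count fst (conv a b) = a.
  rewrite count_map -size_filter /= -[X in iota _ X](subnKC (leq_maxl a b)).
  by rewrite (@filter_iota_ltn 0 _ a) ?size_iota ?leq_addr.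
have c2 a b : count snd (conv a b) = b.
  rewrite count_map -size_filter /= -[X in iota _ X](subnKC (leq_maxr a b)).
  by rewrite (@filter_iota_ltn 0 _ b) ?size_iota ?leq_addr.
by move=> e; split; [rewrite -(c1 m n) e | rewrite -(c2 m n) e].
Qed.

Lemma recognizesE A E m n : recognizes A E -> E m n = accepts A (conv m n).
Proof.
move=> rec; apply/idP/idP => [Emn|/rec[m' [n' [Emn /conv_inj[-> ->]]]]//].
by apply/rec; exists m, n.
Qed.

(** The rows of five entries start after the two header cells, whence [j + 2]. *)
Lemma nth_encode A (s : state A) j : j < 5 ->
  nth 0 (encode A) (5 * s + (j + 2)) = nth 0 (encode_state s) j.
Proof.
move=> jb; rewrite addnA addnC /= nth_flatten_const //.
  by rewrite (nth_map s) ?size_enum_ord // nth_ord_enum.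
by rewrite all_map; apply/allP.
Qed.

Lemma size_encode A : size (encode A) = 5 * nstates A + 2.
Proof.
rewrite /= size_flatten /shape -map_comp addn2; congr _.+2.
by rewrite -[X in 5 * X]card_ord cardE; elim: (enum _) => //= s l ->; rewrite mulnS.
Qed.

(* [w m d] is the state reached by reading (1,1)^m (dia,1)^d. *)
Record is_walk A p (w : nat -> nat -> state A) : Prop := IsWalk {
  walk_init : w 0 0 = init A;
  walk_one : forall m, delta (w m 0) one_one = Some (w m.+1 0);
  walk_dia : forall m d, d < p -> delta (w m d) dia_one = Some (w m d.+1);
  walk_end : forall m, delta (w m p) dia_one = None;
  walk_per : forall m d, p <= m -> w (m + p) d = w m d
}.

Section Walk.
Variables (A : dfa) (p : nat).
Hypothesis stdA : standard_one_loop A p.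

Lemma standard_gt0 : 0 < p.
Proof. by case: stdA => tl [lp [[[_ _ _ + _] _] _ <- _]]; rewrite -size_eq0 lt0n. Qed.

(** Index in [tl ++ lp] of the state reached by (1,1)^m, the tail filling the first [p]
    positions. *)
Definition bounce (m : nat) : nat := if m < p then m else p + (m - p) %% p.

Lemma standard_walk : exists w, @is_walk A p w.
Proof.
have p0 := standard_gt0; move: stdA => [tl [lp [[[]]]]].
set sq := tl ++ lp; case Esq: sq => [|s0 s] //=.
move=> [def0] _ sorteds _ cyc _ stl slp tails.
have ssq : size sq = p + p by rewrite size_cat stl slp.
pose q m := nth (init A) sq (bounce m).
have bounce_lt m : bounce m < p + p.
  by rewrite /bounce; case: ifP => [|_]; [lia | rewrite ltn_add2l ltn_pmod].
have q11 m : delta (q m) one_one = Some (q m.+1).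
  have sqn i : i.+1 < p + p -> delta (nth (init A) sq i) one_one = Some (nth (init A) sq i.+1).
    move=> ip; apply/eqP; have /(sortedP (init A)) : sorted (trans one_one) sq by rewrite Esq.
    by apply; rewrite ssq.
  (* Three cases: inside the tail, from its end into the loop, and around the loop. *)
  have [mp|mp] := ltnP m.+1 p.
    by rewrite /q /bounce mp (ltnW mp); apply: sqn; lia.
  have [pm|pm] := ltnP m p.
    rewrite /q /bounce pm ltnNge mp /=; have -> : m.+1 - p = 0 by lia.
    by rewrite mod0n addn0 sqn; [congr (Some (nth _ _ _)); lia | lia].
  have qE i : p <= i -> q i = nth (init A) lp ((i - p) %% p).
    by move=> pi; rewrite /q /bounce ltnNge pi /= /sq nth_cat stl ltnNge leq_addr addKn.
  rewrite !qE // subSn //.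
  set i := (m - p) %% p; have ip : i < p by rewrite ltn_pmod.
  have -> : (m - p).+1 %% p = if i.+1 == p then 0 else i.+1.
    rewrite -addn1 -modnDml -/i addn1; case: eqP => [->|]; rewrite ?modnn // => ne.
    by rewrite modn_small // ltn_neqAle ip andbT; apply/eqP.
  by have := nth_cycle (init A) cyc; move/(_ i); rewrite slp => /(_ ip)/eqP.
(* The default of [odflt] matters only past the end of the tail, where the walk stays put. *)
pose w m d := iter d (fun u => odflt u (delta u dia_one)) (q m).
have wl m : exists l, [/\ size l = p, path (trans dia_one) (q m) l,
    delta (last (q m) l) dia_one = None
  & forall d, d <= p -> w m d = nth (q m) (q m :: l) d].
  have [|//|l [[_ pl nl] sl]] := tails (q m) dia_one; first by rewrite -Esq mem_nth // ssq.
  exists l; split=> //; elim=> [|d IH] dp //.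
  rewrite /w iterS -/(w m d) IH ?(ltnW dp) //.
  have /eqP -> : trans dia_one (nth (q m) (q m :: l) d) (nth (q m) l d).
    by apply: (pathP (q m) pl); rewrite sl.
  by [].
exists w; split=> //.
- by rewrite /w /q /= /bounce p0 Esq /= def0.
- move=> m d dp; have [l [sl pl nl wE]] := wl m.
  rewrite !wE ?(ltnW dp) //=; apply/eqP.
  by apply: (pathP (q m) pl); rewrite sl.
- move=> m; have [l [sl pl nl wE]] := wl m.
  by rewrite wE // -nl -sl (last_nth (q m)).
- by move=> m d pm; rewrite /w /q /bounce !ltnNge pm
     (leq_trans pm (leq_addr _ _)) /= -addnBAC // modnDr.
Qed.

End Walk.

(** * Edges read off the walk *)

Lemma run_cat A (s : state A) w1 w2 :
  run s (w1 ++ w2) = obind (fun t => run t w2) (run s w1).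
Proof. by elim: w1 s => //= a w1 IH s; case: (delta s a). Qed.

Section Edges.
Variables (A : dfa) (E : rel nat) (p : nat) (w : nat -> nat -> state A).
Hypotheses (recE : recognizes A E) (symE : symmetric E) (wP : is_walk p w).

(** After (1,1)^m the run enters a (dia,1)-tail, which has no transition after [p] letters; hence
    [d <= p]. *)
Lemma edge_walk m d : E m (m + d) = (d <= p) && final (w m d).
Proof.
have run1 k j : run (w k 0) (nseq j one_one) = Some (w (k + j) 0).
  elim: j k => [|j IH] k /=; first by rewrite addn0.
  by rewrite (walk_one wP) IH addSnnS.
have run2 k j : k <= p ->
    run (w m k) (nseq j dia_one) = if k + j <= p then Some (w m (k + j)) else None.
  elim: j k => [|j IH] k kp /=; first by rewrite addn0 kp.
  have [kp'|pk] := ltnP k p; first by rewrite (walk_dia wP) // IH // addSnnS.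
  have -> : k = p by lia.
  by rewrite (walk_end wP); case: ifP => //; lia.
rewrite (recognizesE _ _ recE) conv_addn /accepts run_cat -(walk_init wP) run1 /=.
by rewrite add0n run2 // add0n; case: ifP.
Qed.

Lemma edge_length m n : E m n -> n <= m + p.
Proof.
have [nm|mn] := leqP n m; first by lia.
by rewrite -{1}(subnKC (ltnW mn)) edge_walk => /andP[]; lia.
Qed.

Lemma edge_periodic m n : p <= m -> p <= n -> E (m + p) (n + p) = E m n.
Proof.
wlog mn : m n / m <= n => [H pm pn|pm _].
  by case/orP: (leq_total m n) => le; [|rewrite symE [RHS]symE]; apply: H.
by rewrite -(subnKC mn) addnAC !edge_walk (walk_per wP).
Qed.

Lemma connected_walk : 0 < p -> graph_connected E <->
  forall x, x < 3 * p -> reach E (itv 0 (p * (p + 2))) 0 x.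
Proof.
by apply: connected_bounded; [apply: symE | apply: edge_length | apply: edge_periodic].
Qed.

End Edges.

(** * Structured programs *)

Inductive cmd :=
| Blk of seq instr
| Seq of cmd & cmd
| If of nat & cmd
| While of nat & cmd.

Definition is_jump (i : instr) : bool := if i is IJz _ _ then true else false.

(* Register 1 serves for the unconditional backward jump of a loop. *)
Fixpoint compile (l : nat) (c : cmd) : program :=
  match c with
  | Blk b => b
  | Seq c1 c2 => let P := compile l c1 in P ++ compile (l + size P) c2
  | If r c => let P := compile l.+1 c in IJz r (l.+1 + size P) :: P
  | While r c => let P := compile l.+1 c in
      IJz r (l + size P + 3) :: P ++ [:: IConst 1 0; IJz 1 l]
  end.

Definition assertion := (nat -> nat) -> (nat -> nat) -> Prop.

(** A Hoare triple with a time bound. Jumps are absolute, so the code is compiled for its address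
    [l]; arbitrary surroundings [pre] and [post] make the triples composable. *)
Definition ok (c : cmd) (R M : nat -> nat) (T : nat) (Q : assertion) : Prop :=
  forall P l pre post, size pre = l -> P = pre ++ compile l c ++ post ->
  exists t R' M', [/\ t <= T,
    iter t (step P) (Config l R M) = Config (l + size (compile l c)) R' M'
    & Q R' M'].

(** Weakest precondition of a straight-line block, computed by symbolic execution. *)
Fixpoint blk (b : seq instr) (R M : nat -> nat) (Q : assertion) : Prop :=
  if b is i :: b' then
    let: Config _ R' M' := exec i (Config 0 R M) in blk b' R' M' Q
  else Q R M.

Lemma step_onth P l i R M pre post : size pre = l -> P = pre ++ i :: post ->
  step P (Config l R M) = exec i (Config l R M).
Proof. by move=> <- ->; rewrite /step onth_cat /= ltnn subnn. Qed.

Lemma ok_le c R M T T' (Q Q' : assertion) : ok c R M T Q -> T <= T' ->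
  (forall R' M', Q R' M' -> Q' R' M') -> ok c R M T' Q'.
Proof.
move=> H TT' QQ' P l pre post spre defP.
have [t [R' [M' [tT ? /QQ' ?]]]] := H P l pre post spre defP.
by exists t, R', M'; split=> //; apply: leq_trans TT'.
Qed.

Lemma ok_blk b R M Q : ~~ has is_jump b -> blk b R M Q -> ok (Blk b) R M (size b) Q.
Proof.
move=> + + P l pre post /=.
elim: b R M l pre => [|i b IH] R M l pre /=.
  by move=> _ H spre defP; exists 0, R, M; rewrite addn0.
rewrite negb_or => /andP[ji jb] H spre defP.
have [R' [M' [Ei H']]] : exists R' M',
    exec i (Config l R M) = Config l.+1 R' M' /\ blk b R' M' Q.
  by case: i ji H {defP} => //= *; eexists; eexists; split; eauto.
have [||t [R2 [M2 [tb Et HQ]]]] := IH R' M' l.+1 (rcons pre i) jb H'.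
- by rewrite size_rcons spre.
- by rewrite defP cat_rcons.
exists t.+1, R2, M2; split=> //.
by rewrite iterSr (step_onth _ _ spre defP) Ei Et addSnnS.
Qed.

Lemma ok_seq c1 c2 R M T1 T2 Q :
  ok c1 R M T1 (fun R' M' => ok c2 R' M' T2 Q) ->
  ok (Seq c1 c2) R M (T1 + T2) Q.
Proof.
move=> H P l pre post spre /=; rewrite -catA => defP.
have [t1 [R1 [M1 [le1 E1 H1]]]] := H P l pre _ spre defP.
have [||t2 [R2 [M2 [le2 E2 HQ]]]] :=
  H1 P (l + size (compile l c1)) (pre ++ compile l c1) post.
- by rewrite size_cat spre.
- by rewrite -catA.
exists (t2 + t1), R2, M2; split=> //; first by lia.
by rewrite iterD E1 E2 size_cat addnA.
Qed.

Lemma ok_if r c R M T (Q : assertion) :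
  (R r = 0 -> Q R M) -> (R r != 0 -> ok c R M T Q) -> ok (If r c) R M T.+1 Q.
Proof.
move=> H0 H1 P l pre post spre /= defP.
have := step_onth R M spre defP; case: (eqVneq (R r) 0) => [R0|R1] E1.
  exists 1, R, M; split=> //; last exact: H0.
  by rewrite /= E1 /= R0 /=; congr Config; lia.
have [||t [R2 [M2 [le2 E2 HQ]]]] :=
  H1 R1 P l.+1 (rcons pre (IJz r (l.+1 + size (compile l.+1 c)))) post.
- by rewrite size_rcons spre.
- by rewrite cat_rcons defP.
exists t.+1, R2, M2; split=> //.
by rewrite iterSr E1 /= (negPf R1) E2 addSnnS.
Qed.

(** [k] is a variant. Each round costs the test and the two instructions jumping back, whence 3; the
    last test gives the final 1. [upd R' 1 0] accounts for the register used by the jump. *)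
Lemma ok_while (I : nat -> assertion) r c R M T k :
  (forall k R M, I k R M -> R r != 0 ->
     ok c R M T (fun R' M' => exists k', k' < k /\ I k' (upd R' 1 0) M')) ->
  I k R M ->
  ok (While r c) R M (k * (T + 3)).+1
    (fun R' M' => R' r = 0 /\ exists k', I k' R' M').
Proof.
move=> body; elim/ltn_ind: k R M => k IH R M Ik P l pre post spre /= defP.
have := step_onth R M spre defP; case: (eqVneq (R r) 0) => [R0|R1] E1.
  exists 1, R, M; split=> //; last by split=> //; exists k.
  by rewrite /= E1 /= R0 /= size_cat /=; congr Config; lia.
set J := IJz r _ in defP E1.
have [||t [R2 [M2 [le2 E2 [k' [lt_k' Ik']]]]]] :=
    body k R M Ik R1 P l.+1 (rcons pre J) ([:: IConst 1 0; IJz 1 l] ++ post).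
- by rewrite size_rcons spre.
- by rewrite cat_rcons defP -catA.
have [t' [R3 [M3 [le3 E3 HQ]]]] := IH k' lt_k' _ _ Ik' P l pre post spre defP.
exists (t' + (2 + (t + 1))), R3, M3; split=> //.
  have : k' * (T + 3) + (T + 3) <= k * (T + 3).
    by rewrite addnC -mulSn leq_mul2r lt_k' orbT.
  by lia.
have defP' : P = (pre ++ J :: compile l.+1 c) ++ IConst 1 0 :: IJz 1 l :: post.
  by rewrite defP -!catA.
rewrite 2!iterD iterD /= E1 /= (negPf R1) E2.
rewrite (step_onth _ _ _ defP') ?size_cat /= ?spre ?addnS // -?addSn.
have defP2 : P = rcons (pre ++ J :: compile l.+1 c) (IConst 1 0) ++ IJz 1 l :: post.
  by rewrite cat_rcons.
rewrite (step_onth _ _ _ defP2) ?size_rcons ?size_cat /= ?spre ?addnS //.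
by rewrite E3 /= size_cat /=; congr Config; lia.
Qed.

Lemma ok_decides c input T (Q : Prop) :
  ok c (fun=> 0) (nth 0 input) T
    (fun R _ => exists b : bool, R 0 = b /\ (b <-> Q)) ->
  decides_within (compile 0 c) input T Q.
Proof.
move=> H.
have [|t [R [M [le_t Et HQ]]]] := H (compile 0 c) 0 [::] [::] erefl.
  by rewrite cats0.
by exists t; rewrite /start Et; split=> //; rewrite /halted /= add0n.
Qed.

(** * The decision procedure *)

(* Register 10 holds the code t + 1 of a state t; it becomes 0 if t has no
   (dia,1)-transition. *)
Definition next_dia : seq instr :=
  [:: IAdd 11 10 10; IAdd 11 11 11; IAdd 11 11 10; ISub 11 11 5; ILoad 10 11].

(** Measures [p] in register 2, while [N] is accumulated in register 3 by additions, since the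
    machine cannot multiply. *)
Definition setup : cmd :=
  Seq (Blk ([:: IConst 5 1; IConst 7 0; ILoad 8 7; IAdd 4 8 8; IAdd 4 4 4;
                IAdd 4 4 8; IAdd 4 4 5; IAdd 4 4 5; ILoad 9 5; IAdd 9 9 5;
                IConst 10 0; IAdd 10 10 9] ++ next_dia))
  (Seq (While 10 (Blk ([:: IAdd 2 2 5; IAdd 3 3 2; IAdd 3 3 2; IAdd 3 3 5] ++ next_dia)))
       (Blk [:: IAdd 6 4 3])).

Definition fill_row : cmd :=
  Blk ([:: ISub 15 15 5] ++ next_dia ++
       [:: IAdd 14 14 3; IAdd 11 10 10; IAdd 11 11 11; IAdd 11 11 10;
           IAdd 11 11 5; ILoad 16 11; IStore 14 16]).

(** The outer loop follows (1,1)-transitions through the vertices below [N], the inner one the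
    (dia,1)-tail of the state reached. For a state code [c], the (1,1)-entry is at address
    [5c - 3]. *)
Definition fill : cmd :=
  Seq (Blk [:: IConst 12 0; IAdd 12 12 3; IConst 13 0; IAdd 13 13 6])
  (While 12
    (Seq (Blk [:: IConst 10 0; IAdd 10 10 9; IConst 14 0; IAdd 14 14 13;
                  IConst 15 0; IAdd 15 15 2])
    (Seq (While 15 fill_row)
         (Blk [:: IAdd 11 9 9; IAdd 11 11 11; IAdd 11 11 9; ISub 11 11 5;
                  ISub 11 11 5; ISub 11 11 5; ILoad 9 11; IAdd 13 13 5;
                  ISub 12 12 5])))).

(** * Symbolic execution of blocks *)

Lemma blk_const r c b R M Q :
  blk b (upd R r c) M Q -> blk (IConst r c :: b) R M Q.
Proof. by []. Qed.

Lemma blk_add v r x y b R M Q : v = R x + R y ->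
  blk b (upd R r v) M Q -> blk (IAdd r x y :: b) R M Q.
Proof. by move=> ->. Qed.

Lemma blk_sub v r x y b R M Q : v = R x - R y ->
  blk b (upd R r v) M Q -> blk (ISub r x y :: b) R M Q.
Proof. by move=> ->. Qed.

Lemma blk_load v r x b R M Q : v = M (R x) ->
  blk b (upd R r v) M Q -> blk (ILoad r x :: b) R M Q.
Proof. by move=> ->. Qed.

Lemma blk_store a v x y b R M Q : a = R x -> v = R y ->
  blk b R (upd M a v) Q -> blk (IStore x y :: b) R M Q.
Proof. by move=> -> ->. Qed.

Lemma blk_nil R M (Q : assertion) : Q R M -> blk [::] R M Q.
Proof. by []. Qed.

Opaque blk.

(* The values written are simplified at once: they would otherwise grow
   exponentially with the length of the block. *)
Ltac value := rewrite ?{1}/upd /=; reflexivity.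
Ltac exec_instr :=
  first [ eapply blk_const
        | eapply blk_add; [value|]
        | eapply blk_sub; [value|]
        | eapply blk_load; [value|]
        | eapply blk_store; [value|value|] ].
Ltac exec_blk :=
  apply: ok_blk; [by []|rewrite /next_dia ?cat_cons ?cat0s; do ?exec_instr;
                        eapply blk_nil].

Definition visit (u : nat) : cmd :=
  Seq (Blk [:: IAdd 8 6 u; ILoad 7 8; ISub 7 5 7])
      (If 7 (Blk [:: IStore 8 5; IStore 18 u; IAdd 18 18 5])).

(** Registers 21 and 22 hold [v + e] and [v - e]; 13 and 14 point to the table entries of the edges
    from [v] to them, the second one being stored with its lower end [v - e]. If register 22 is
    already 0, nothing lies further left. *)
Definition scan : cmd :=
  Seq (Blk [:: ISub 15 15 5; IAdd 21 21 5; IAdd 13 13 3; ISub 16 3 21; ILoad 11 13])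
  (Seq (If 16 (If 11 (visit 21)))
       (If 22 (Seq (Blk [:: ISub 22 22 5; IAdd 14 14 3; ISub 14 14 5; ILoad 11 14])
                   (If 11 (visit 22))))).

(** Registers 17 and 18 point to the head and the end of the queue. Vertex 0 is only marked: the
    first queue cell already contains 0. *)
Definition search : cmd :=
  Seq (Blk [:: IStore 6 5; IConst 17 0; IAdd 17 17 4; IAdd 18 4 5; IConst 19 1])
  (While 19
    (Seq (Blk [:: ILoad 20 17; IAdd 17 17 5; IConst 15 0; IAdd 15 15 2;
                  IConst 21 0; IAdd 21 21 20; IConst 22 0; IAdd 22 22 20;
                  IAdd 13 6 20; IConst 14 0; IAdd 14 14 13])
    (Seq (While 15 scan)
         (Blk [:: ISub 19 18 17])))).

Definition check : cmd :=
  Seq (Blk [:: IConst 0 1; IConst 13 0; IAdd 13 13 6; IAdd 15 2 2; IAdd 15 15 2])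
  (While 15
    (Seq (Blk [:: ISub 15 15 5; ILoad 11 13; IAdd 13 13 5; ISub 11 5 11])
         (If 11 (Blk [:: IConst 0 0])))).

(** * Correctness and running time of the procedure *)

Section Program.
Variables (A : dfa) (E : rel nat) (p : nat) (w : nat -> nat -> state A).
Hypotheses (recE : recognizes A E) (symE : symmetric E) (wP : is_walk p w).
Hypothesis p_gt0 : 0 < p.

Variables (N B : nat) (input : nat -> nat).
Hypotheses (defN : N = p * (p + 2)) (defB : B = 5 * nstates A + 2).
Hypothesis defI : input = nth 0 (encode A).

Definition code (o : option (state A)) : nat := if o is Some t then t.+1 else 0.

Lemma input_one m : input (5 * w m 0 + 2) = code (delta (w m 0) one_one).
Proof. by have /= H := @nth_encode A (w m 0) 0 isT; rewrite defI H. Qed.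

Lemma input_dia m d : input (5 * w m d + 4) = code (delta (w m d) dia_one).
Proof. by have /= H := @nth_encode A (w m d) 2 isT; rewrite defI H. Qed.

Lemma input_final m d : input (5 * w m d + 6) = final (w m d).
Proof. by have /= H := @nth_encode A (w m d) 4 isT; rewrite defI H. Qed.

(* B is the length of the input, which the work space follows. *)
Definition static (R : nat -> nat) :=
  [/\ R 2 = p, R 3 = N, R 4 = B, R 5 = 1 & R 6 = B + N].

Lemma input_lt m d : 5 * w m d + 6 < B.
Proof. by have := ltn_ord (w m d); rewrite defB; lia. Qed.

Lemma setup_ok R : R 2 = 0 -> R 3 = 0 ->
  ok setup R input (12 * p + 19)
    (fun R' M' => [/\ static R', R' 9 = (w 0 0).+1 & M' = input]).
Proof.
move=> R2 R3.
(* Register 10 codes the next (dia,1)-transition and vanishes exactly when [i = p]. Register 3 is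
   kept up by [(i + 1) * (i + 3) = i * (i + 2) + 2 * (i + 1) + 1]. *)
pose I k (R M : nat -> nat) := M = input /\ exists i,
  [/\ i + k = p, R 2 = i, R 3 = i * (i + 2), R 4 = B &
   [/\ R 5 = 1, R 9 = (w 0 0).+1 & R 10 = code (delta (w 0 i) dia_one)]].
have in0 : input 0 = nstates A by rewrite defI.
have in1 : input 1 = w 0 0 by rewrite defI (walk_init wP).
eapply ok_le; [|shelve|by move=> R' M'; apply].
eapply ok_seq; exec_blk.
eapply ok_seq; eapply ok_le.
- apply: (@ok_while I _ _ _ _ _ p) => [k {R2 R3}R M [->{M}]|].
    case=> i [ik R2 R3 R4 [R5 R9 R10]] R10n.
    have ip : i < p.
      rewrite ltnNge; apply: contraNN R10n => pi.
      have e : i = p by lia.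
      by rewrite R10 e (walk_end wP).
    rewrite (walk_dia wP) //= in R10.
    exec_blk; exists k.-1; split; first by lia.
    split=> //; exists i.+1; rewrite /upd /= R2 R3 R4 R5 R9 R10; split=> //; try lia.
    split=> //; rewrite -input_dia; congr input; lia.
  split=> //; exists 0; rewrite /upd /= R2 R3 in0 in1 defB; split=> //; try lia.
  by split=> //; rewrite -?input_dia; [lia | congr input; lia].
- exact: leqnn.
- move=> {R2 R3}R M [R10 [k [-> [i [ik R2 R3 R4 [R5 R9 R10']]]]]].
  have ip : i = p.
    suff : ~~ (i < p) by lia.
    by apply/negP => ip; rewrite R10' (walk_dia wP) in R10.
  exec_blk; rewrite /static /upd /= R2 R3 R4 R5 R9 ip defN; split=> //.
Unshelve. rewrite /=; lia.
Qed.

(* The queue occupies the N cells below [tbl 0 0]; [tbl 0 u] marks u as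
   visited, and for d > 0 the cell [tbl d u] tells whether (u, u + d) is an
   edge. *)
Definition tbl d u := B + N + (N * d + u).

(** [d] and [u] are the quotient and the remainder by [N] of the offset. *)
Lemma tbl_inj d u d' u' : u < N -> u' < N -> tbl d u = tbl d' u' -> d = d' /\ u = u'.
Proof.
move=> uN u'N /addnI e; have N0 : 0 < N by lia.
have : (N * d + u) %/ N = (N * d' + u') %/ N by rewrite e.
rewrite ![N * _]mulnC !divnMDl // !divn_small // !addn0 => ed; split=> //.
by move: e; rewrite ed => /addnI.
Qed.

(** Vertices are treated in increasing order, and so are the distances for the vertex [v] in
    progress. The zero cells are the queue and the visited marks. *)
Definition filled v d (M : nat -> nat) :=
  [/\ forall a, a < B -> M a = input a,
      forall a, B <= a < B + N + N -> M a = 0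
    & forall e u, 0 < e <= p -> u < N -> u < v \/ u = v /\ e <= d ->
        M (tbl e u) = E u (u + e)].

Lemma filled_upd v d M : v < N -> d < p -> filled v d M ->
  filled v d.+1 (upd M (tbl d.+1 v) (final (w v d.+1))).
Proof.
move=> vN dp [Mi M0 Mt]; rewrite /upd; split=> [a aB|a aB|e u ep uN uv].
- by rewrite ifF ?Mi //; rewrite /tbl; nia.
- by rewrite ifF ?M0 //; rewrite /tbl; nia.
case: eqP => [/(tbl_inj uN vN)[-> ->]|ne].
  by rewrite (edge_walk recE wP) dp.
apply: Mt => //; case: uv => [|[uv ed]]; [by left|right; split=> //].
by move: ed; rewrite leq_eqVlt ltnS => /orP[/eqP ed|//]; case: ne; rewrite ed uv.
Qed.

Lemma fill_ok R : static R -> R 9 = (w 0 0).+1 ->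
  ok fill R input (N * (p * 16 + 22) + 8)
    (fun R' M' => static R' /\ filled N 0 M').
Proof.
move=> stR R9.
pose I k (R M : nat -> nat) := static R /\ exists v,
  [/\ v + k = N, R 12 = k, R 9 = (w v 0).+1, R 13 = B + N + v & filled v 0 M].
pose J v k (R M : nat -> nat) := static R /\ exists d,
  [/\ d + k = p, R 15 = k, R 10 = (w v d).+1, R 14 = tbl d v &
   [/\ R 12 + v = N, R 9 = (w v 0).+1, R 13 = B + N + v & filled v d M]].
eapply ok_le; [|shelve|by move=> R' M'; apply].
eapply ok_seq; exec_blk.
eapply ok_le.
- apply: (@ok_while I _ _ _ _ _ N) => [k {stR R9}R M [[R2 R3 R4 R5 R6]]|].
    case=> v [vk R12 R9 R13 fM] k0.
    have vN : v < N by lia.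
    eapply ok_seq; exec_blk.
    eapply ok_seq; eapply ok_le.
    + apply: (@ok_while (J v) _ _ _ _ _ p) =>
        [j {R2 R3 R4 R5 R6 R9 R12 R13 fM k0}R {}M [[R2 R3 R4 R5 R6]]|].
        case=> d [dj R15 R10 R14 [R12 R9 R13 fM]] j0.
        have dp : d < p by lia.
        have [Mi _ _] := fM.
        (* A state [t] is held in a register as [t + 1]: its (dia,1)-entry is at [5(t + 1) - 1], its
           final bit at [5(t + 1) + 1]. *)
        have e4 : (w v d).+1 + (w v d).+1 + ((w v d).+1 + (w v d).+1) +
            (w v d).+1 - 1 = 5 * w v d + 4 by lia.
        have M4 : M (5 * w v d + 4) = (w v d.+1).+1.
          by rewrite Mi ?input_dia ?(walk_dia wP) //; have := input_lt v d; lia.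
        have e6 : (w v d.+1).+1 + (w v d.+1).+1 +
            ((w v d.+1).+1 + (w v d.+1).+1) + (w v d.+1).+1 + 1 =
            5 * w v d.+1 + 6 by lia.
        exec_blk; exists j.-1; split; first by lia.
        rewrite /J /static /upd /= R2 R3 R4 R5 R6 R9 R10 R12 R13 R14 R15 e4 M4 e6.
        split=> //; exists d.+1; split=> //; try lia.
          by rewrite /tbl mulnS; lia.
        have -> : tbl d v + N = tbl d.+1 v by rewrite /tbl mulnS; lia.
        split=> //.
        by rewrite Mi ?input_final ?input_lt //; apply: filled_upd.
      rewrite /J /static /upd /= R2 R3 R4 R5 R6 R9 R12 R13; split=> //; exists 0.
      by split=> //; [rewrite /tbl muln0; lia | split=> //; lia].
    + exact: leqnn.
    + move=> {R2 R3 R4 R5 R6 R9 R12 R13 fM k0}R {}M [R15' [j [[R2 R3 R4 R5 R6]]]].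
      case=> d [dj R15 R10 R14 [R12 R9 R13 fM]].
      have {R15' R15} dp : d = p by lia.
      have [Mi M0 Mt] := fM.
      exec_blk; exists k.-1; split; first by lia.
      rewrite /I /static /upd /= R2 R3 R4 R5 R6 R9 R13; split=> //; exists v.+1.
      split=> //; try lia.
        have -> : (w v 0).+1 + (w v 0).+1 + ((w v 0).+1 + (w v 0).+1) +
            (w v 0).+1 - 1 - 1 - 1 = 5 * w v 0 + 2 by lia.
        by rewrite Mi ?input_one ?(walk_one wP) //; have := input_lt v 0; lia.
      split=> // e u ep uN uv; apply: Mt => //; rewrite dp.
      by lia.
  case: stR => R2 R3 R4 R5 R6.
  rewrite /I /static /upd /= R2 R3 R4 R5 R6 R9; split=> //; exists 0; split=> //; try lia.
  split=> // [a aB|e u ep uN]; last by case; lia.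
  (* Memory beyond the input is initially 0. *)
  by rewrite defI nth_default // size_encode -defB; lia.
- exact: leqnn.
- move=> {stR R9}R M [R12' [k [stR [v [vk R12 R9 R13 fM]]]]]; split=> //.
  by have <- : v = N by lia.
Unshelve. rewrite /=; lia.
Qed.

Let D : pred nat := itv 0 N.

(** [s] lists the vertices discovered so far in queue order. Entries are never removed, so [s] is at
    once the queue and the visited set. *)
Definition bfs (s : seq nat) (R M : nat -> nat) : Prop :=
  [/\ static R /\ R 18 = B + size s,
      forall e u, 0 < e <= p -> u < N -> M (tbl e u) = E u (u + e),
      [/\ uniq s, 0 \in s & forall x, x \in s -> reach E D 0 x],
      forall i, i < size s -> M (B + i) = nth 0 s i
    & forall x, x < N -> M (tbl 0 x) = (x \in s)].

Lemma bfs_lt s R M x : bfs s R M -> x \in s -> x < N.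
Proof. by case=> _ _ [_ _ H] _ _ /H/reach_dom[_]; rewrite /D /itv. Qed.

(** Shows that the queue fits in its [N] cells, and bounds the number of rounds of the search. *)
Lemma bfs_size s R M : bfs s R M -> size s <= N.
Proof.
move=> H; rewrite -(size_iota 0 N); apply: uniq_leq_size; first by case: H => _ _ [].
by move=> x /(bfs_lt H); rewrite mem_iota.
Qed.

Lemma bfs_upd s R M r x : r \notin [:: 2; 3; 4; 5; 6; 18] ->
  bfs s R M -> bfs s (upd R r x) M.
Proof.
rewrite !inE !negb_or => /and5P[n2 n3 n4 n5 /andP[n6 n18]].
move=> [[[R2 R3 R4 R5 R6] R18] *]; split=> //; rewrite /static /upd.
by rewrite ![_ == r]eq_sym !ifN.
Qed.

(** [t] is empty if the vertex was already marked, a singleton otherwise; the last clause preserves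
    the registers of the enclosing loop. *)
Lemma visit_ok u s R M : u \in [:: 21; 22] -> bfs s R M -> reach E D 0 (R u) ->
  ok (visit u) R M 7 (fun R' M' => exists t, [/\ bfs (s ++ t) R' M', R u \in s ++ t
    & forall r, r \notin [:: 7; 8; 18] -> R' r = R r]).
Proof.
move=> uP bP rP; have [_ uN] := reach_dom rP; rewrite /D /itv /= in uN.
have bP' := bP; case: bP' => [[[R2 R3 R4 R5 R6] R18] Mt [us s0 rs] Mq Mv].
have tu : tbl 0 (R u) = R 6 + R u by rewrite R6 /tbl muln0.
have Mu := Mv _ uN; rewrite tu in Mu.
have frame x y r : r \notin [:: 7; 8; 18] ->
    upd (upd (upd R 8 x) 7 y) 7 y r = R r.
  by rewrite !inE !negb_or /upd => /and3P[/negPf-> /negPf-> _].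
have u7 : u \notin [:: 7; 8; 18] by move: uP; rewrite !inE => /orP[]/eqP->.
move: (u7); rewrite !inE !negb_or => /and3P[/negPf u_7 /negPf u_8 /negPf u_18].
apply: (@ok_seq _ _ _ _ 3 4).
have blk3 (Q : assertion) :
   Q (upd (upd (upd R 8 (R 6 + R u)) 7 (M (R 6 + R u))) 7 (1 - M (R 6 + R u))) M ->
   ok (Blk [:: IAdd 8 6 u; ILoad 7 8; ISub 7 5 7]) R M 3 Q.
  by move=> HQ; exec_blk; move: HQ; rewrite R5.
apply: blk3; rewrite Mu.
apply: ok_if => [|].
  rewrite /upd /= => seen; exists [::]; rewrite cats0; split.
  - do !apply: bfs_upd => //.
  - by move: seen; case: (R u \in s).
  - by move=> r; rewrite !inE !negb_or => /and3P[/negPf-> /negPf-> _].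
rewrite {1}/upd /= => new.
have {}new : R u \notin s by move: new; case: (R u \in s).
(* A new vertex leaves room in the queue, so the write at [B + size s] does not touch the marks. *)
have sN : size s < N.
  have /uniq_leq_size : uniq (R u :: s) by rewrite /= new.
  rewrite -[X in _ < X](size_iota 0); apply=> x; rewrite mem_iota inE.
  by case/orP=> [/eqP->//|/(bfs_lt bP)].
have exec3 (R1 : nat -> nat) (Q : assertion) : R1 8 = tbl 0 (R u) -> R1 5 = 1 ->
    R1 18 = B + size s -> R1 u = R u ->
    Q (upd R1 18 (B + size s + 1)) (upd (upd M (tbl 0 (R u)) 1) (B + size s) (R u)) ->
    ok (Blk [:: IStore 8 5; IStore 18 u; IAdd 18 18 5]) R1 M 3 Q.
  by move=> e8 e5 e18 eu HQ; exec_blk; rewrite e8 e5 e18 eu.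
apply: exec3.
- by rewrite /upd /= tu.
- by rewrite /upd.
- by rewrite /upd.
- by rewrite /upd u_7 u_8.
exists [:: R u]; split.
- split.
  + split; first by split=> //; rewrite /upd /=.
    by rewrite /upd /= size_cat /= addnA.
  + move=> e x ep xN; rewrite /upd ifF; last by rewrite /tbl; nia.
    rewrite ifF ?Mt //; apply/eqP => /(tbl_inj xN uN)[e0 _]; lia.
  + split=> [||x]; first by rewrite cats1 rcons_uniq new us.
      by rewrite mem_cat s0.
    by rewrite mem_cat inE => /orP[/rs//|/eqP->].
  + move=> i; rewrite size_cat /= addn1 ltnS leq_eqVlt nth_cat => /orP[/eqP->|si].
      by rewrite /upd eqxx ltnn subnn.
    rewrite si /upd ifF; last by lia.
    by rewrite ifF ?Mq //; rewrite /tbl; lia.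
  + move=> x xN; rewrite /upd mem_cat inE ifF; last by rewrite /tbl; lia.
    case: eqP => [/(tbl_inj xN uN)[_ ->]|ne]; first by rewrite eqxx orbT.
    rewrite Mv //; case: eqP => [e|_]; last by rewrite orbF.
    by rewrite e in ne.
- by rewrite mem_cat inE eqxx orbT.
- by move=> r; rewrite !inE !negb_or /upd => /and3P[/negPf-> /negPf-> /negPf->].
Qed.

Definition explored (s : seq nat) h :=
  forall i x, i < h -> x < N -> E (nth 0 s i) x -> x \in s.

Definition scanned (s : seq nat) v d := forall e, 0 < e <= d ->
  (v + e < N -> E v (v + e) -> v + e \in s) /\ (e <= v -> E (v - e) v -> v - e \in s).

Lemma explored_cat s t h : h <= size s -> explored s h -> explored (s ++ t) h.
Proof.
move=> hs ex i x ih xN; rewrite nth_cat (leq_trans ih hs) mem_cat => Ex.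
by rewrite (ex i).
Qed.

(** The guard on register 14 is there because [v - d] is truncated: past [v] this address is no
    longer maintained. *)
Definition scan_inv h v k (R M : nat -> nat) := exists s d,
  [/\ bfs s R M, h < size s /\ nth 0 s h = v, explored s h, scanned s v d
    & [/\ d + k = p, R 15 = k, R 21 = v + d, R 22 = v - d
    & [/\ R 13 = tbl d v, d <= v -> R 14 = tbl d (v - d) & R 17 = B + h.+1]]].

Lemma scan_ok h v k R M : scan_inv h v k R M -> R 15 != 0 ->
  ok scan R M 27 (fun R' M' => scan_inv h v k.-1 (upd R' 1 0) M').
Proof.
case=> s [d [bP [hs hv] ex sc [dk R15 R21 R22 [R13 R14 R17]]]] R15n.
have dp : d < p by lia.
have [[[R2 R3 R4 R5 R6] R18] Mt [us s0 rs] Mq Mv] := bP.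
have vs : v \in s by rewrite -hv mem_nth.
have vN := bfs_lt bP vs.
apply: (@ok_seq _ _ _ _ 5 22); exec_blk.
rewrite R15 R21 R13 R3 R5.
have -> : v + d + 1 = v + d.+1 by lia.
have -> : tbl d v + N = tbl d.+1 v by rewrite /tbl mulnS; lia.
rewrite Mt //; set R1 := upd _ _ _.
have bP1 : bfs s R1 M by do !apply: bfs_upd => //.
apply: (@ok_seq _ _ _ _ 9 13).
apply: (@ok_le _ _ _ 9 _ (fun R' M' => exists t, [/\ bfs (s ++ t) R' M',
    v + d.+1 < N -> E v (v + d.+1) -> v + d.+1 \in s ++ t
  & forall r, r \notin [:: 7; 8; 18] -> R' r = R1 r])) => //.
  apply: ok_if => [R16|R16].
    exists [::]; rewrite cats0; split=> // lt; move: R16; rewrite /R1 /upd /=; lia.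
  apply: ok_if => [R11|R11].
    exists [::]; rewrite cats0; split=> // _; move: R11; rewrite /R1 /upd /=.
    by case: (E v _).
  have lt : v + d.+1 < N by move: R16; rewrite /R1 /upd /=; lia.
  have Ev : E v (v + d.+1) by move: R11; rewrite /R1 /upd /=; case: (E v _).
  apply: ok_le (@visit_ok 21 s R1 M isT bP1 _) _ _ => //.
    by apply: reach_step (rs _ vs) Ev _; rewrite /D /itv.
  move=> R' M' [t [bt vt fr]]; exists t; split=> //.
move=> {Mt Mq Mv rs us bP1 bP} R' {}M [t [bP fwd fr]].
have R'E r : r \notin [:: 7; 8; 18; 11; 16; 13; 21; 15] -> R' r = R r.
  rewrite !inE !negb_or => /and5P[n7 n8 n18 n11 /and4P[n16 n13 n21 n15]].
  rewrite fr ?inE ?negb_or ?n7 ?n8 //.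
  by rewrite /R1 /upd (negPf n11) (negPf n16) (negPf n13) (negPf n21) (negPf n15).
have hst : h < size (s ++ t) by rewrite size_cat ltn_addr.
have hvt : nth 0 (s ++ t) h = v by rewrite nth_cat hs.
have ext := @explored_cat s t h (ltnW hs) ex.
have sct e : 0 < e <= d ->
    (v + e < N -> E v (v + e) -> v + e \in s ++ t) /\
    (e <= v -> E (v - e) v -> v - e \in s ++ t).
  by case/sc=> H1 H2; rewrite !mem_cat; split=> le Ee; rewrite ?H1 ?H2.
have vst : v \in s ++ t by rewrite mem_cat vs.
have {fr} [f15 f21 f13] : [/\ R' 15 = k - 1, R' 21 = v + d.+1 & R' 13 = tbl d.+1 v].
  by rewrite !fr.
clear R1 sc ex hs hv vs s0 R18.
move: (s ++ t) bP fwd hst hvt ext sct vst => {}s bP fwd hs hv ex sc vs.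
have scS (s' : seq nat) : {subset s <= s'} ->
    (d < v -> E (v - d.+1) v -> v - d.+1 \in s') -> scanned s' v d.+1.
  move=> ss' bwd e /andP[e0]; rewrite leq_eqVlt => /orP[/eqP->|ed].
    by split=> [lt Ee|]; [apply/ss'/fwd | apply: bwd].
  by have [|H1 H2] := sc e; [lia | split=> le Ee; apply: ss'; auto].
have e22 := R'E 22 isT; have e14 := R'E 14 isT; have e17 := R'E 17 isT.
have e3 := R'E 3 isT; have e5 := R'E 5 isT.
rewrite R22 in e22; rewrite R17 in e17; rewrite R3 in e3; rewrite R5 in e5.
(* If register 22 is 0, then [v <= d] and there is no vertex at distance [d + 1] on the left. *)
apply: ok_if => [R22'|R22'].
  exists s, d.+1; split=> //.
    by apply: scS => //; lia.
  by rewrite /upd /= f15 f21 f13 e22 e17; split=> //; try lia; split=> //; lia.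
have dv : d < v by lia.
apply: (@ok_seq _ _ _ _ 4 8); exec_blk.
rewrite e22 e14 e3 e5 (R14 (ltnW dv)).
have -> : tbl d (v - d) + N - 1 = tbl d.+1 (v - d.+1) by rewrite /tbl mulnS; lia.
have -> : v - d - 1 = v - d.+1 by lia.
have [_ Mt [us s0 rs] _ _] := bP.
rewrite Mt //; last by lia.
rewrite subnK //; set R1 := upd _ _ _.
have bP1 : bfs s R1 M by do !apply: bfs_upd => //.
apply: ok_if => [R11|R11].
  exists s, d.+1; split=> //.
    by apply: scS => // _; move: R11; rewrite /R1 /upd /=; case: (E _ v).
  by rewrite /R1 /upd /= f15 f21 f13 e17; split=> //; try lia.
have Ev : E (v - d.+1) v by move: R11; rewrite /R1 /upd /=; case: (E _ v).
apply: ok_le (@visit_ok 22 s R1 M isT bP1 _) _ _ => //.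
  by apply: reach_step (rs _ vs) _ _; [rewrite symE | rewrite /D /itv /R1 /upd /=; lia].
move=> R2' M2 [u [bP' ve fr]]; exists (s ++ u), d.+1; split.
- by do !apply: bfs_upd => //.
- by rewrite size_cat ltn_addr // nth_cat hs.
- exact: explored_cat (ltnW hs) ex.
- by apply: scS => // x; rewrite mem_cat => ->.
- by rewrite /upd /= !fr // /R1 /upd /= f15 f21 f13 e17; split=> //; try lia.
Qed.

(** Edges have length at most [p] in both directions, so scanning distances up to [p] meets every
    neighbour; a self-loop is covered by [v \in s]. *)
Lemma explored_scanned s v h : scanned s v p -> nth 0 s h = v -> v \in s ->
  explored s h -> explored s h.+1.
Proof.
move=> sc hv vs ex i x; rewrite ltnS leq_eqVlt => /orP[/eqP->|/ex]; last exact.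
rewrite hv => xN Evx.
have Exv : E x v by rewrite symE.
have lvx := edge_length recE wP Evx; have lxv := edge_length recE wP Exv.
have [vx|xv|<- //] := ltngtP v x.
  have [|+ _] := sc (x - v); first by lia.
  by rewrite (subnKC (ltnW vx)); apply.
have [|_] := sc (v - x); first by lia.
by rewrite (subKn (ltnW xv)); apply=> //; lia.
Qed.

Lemma search_ok R M : static R -> filled N 0 M ->
  ok search R M (N * (p * 30 + 16) + 6) (fun R' M' => exists s : seq nat,
    [/\ static R', forall x, x < N -> M' (tbl 0 x) = (x \in s)
      & forall x, x \in s <-> reach E D 0 x]).
Proof.
move=> stR [Mi M0 Mt]; have N0 : 0 < N by rewrite defN; nia.
(* [h] queue entries have been explored. As [h] never exceeds [size s], hence [N], the difference
   [N - h] serves as the variant. *)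
pose L k (R M : nat -> nat) := exists s h,
  [/\ bfs s R M, R 17 = B + h, R 19 = size s - h, h <= size s
    & explored s h /\ h + k = N].
eapply ok_le; [|shelve|by move=> R' M'; apply].
eapply ok_seq; exec_blk.
eapply ok_le.
- apply: (@ok_while L _ _ _ _ _ N) => [k {stR Mi M0 Mt}R {}M|].
    case=> s [h [bP R17 R19 hs [ex hk]]] R19n.
    have [[[R2 R3 R4 R5 R6] R18] Mt [us s0 rs] Mq Mv] := bP.
    have {}hs : h < size s by lia.
    have sN := bfs_size bP.
    have vs : nth 0 s h \in s by rewrite mem_nth.
    eapply ok_seq; exec_blk.
    rewrite R17 Mq // R2 R5 R6; move: vs; set v := nth 0 s h => vs.
    eapply ok_seq; eapply ok_le.
    + apply: (@ok_while (scan_inv h v) _ _ _ _ _ p) => [j R1 M1 sP R15|].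
        apply: ok_le (scan_ok sP R15) (leqnn _) _ => R2' M2 sP'.
        exists j.-1; split=> //.
        by case: sP => ? [? [_ _ _ _ [_ R15' _ _ _]]]; lia.
      exists s, 0; split=> //.
      * by move=> e; lia.
      * by rewrite /upd /= /tbl muln0 subn0; split=> //; try lia; split=> //; lia.
    + exact: leqnn.
    + move=> R1 M1 [R15 [j [s1 [d [bP1 [hs1 hv1] ex1 sc1 [dj R15' _ _ [_ _ R17']]]]]]].
      have dp : d = p by lia.
      exec_blk; exists k.-1; split; first by lia.
      have [[_ R18'] _ _ _ _] := bP1.
      have vs1 : v \in s1 by rewrite -hv1 mem_nth.
      exists s1, h.+1; split.
      * by do !apply: bfs_upd => //.
      * by rewrite /upd /=.
      * by rewrite /upd /= R18' R17'; lia.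
      * by [].
      * split; last by lia.
        by apply: explored_scanned hv1 vs1 ex1; rewrite -dp.
  exists [:: 0], 0; split=> //.
  + case: stR => R2 R3 R4 R5 R6; split=> //.
    * by rewrite /static /upd /= R4 R5 addn1.
    * move=> e u ep uN; rewrite /upd ifF ?Mt //; first by left.
      by rewrite R6 /tbl; nia.
    * by split=> // x; rewrite inE => /eqP->; apply: reach_refl; rewrite /D /itv.
    * case=> // _; rewrite /upd ifF; first by rewrite M0 //; lia.
      by rewrite R6; lia.
    * move=> x xN; rewrite /upd R6 R5 inE; case: eqP => [e|ne].
        by have -> : x = 0 by move: e; rewrite /tbl muln0; lia.
      rewrite M0; last by rewrite /tbl muln0; lia.
      by case: eqP => // x0; case: ne; rewrite x0 /tbl muln0; lia.
  + by rewrite /upd /=; case: stR; lia.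
- exact: leqnn.
- move=> {stR Mi M0 Mt}R {}M [R19 [k [s [h [bP R17 R19' hs [ex hk]]]]]].
  exists s; case: bP => [[stR _] _ [_ s0 rs] _ Mv]; split=> // x; split; first exact: rs.
  (* On exit [h = size s], so [s] is closed under edges inside [[0, N)]. *)
  elim=> [|y z xy ys Eyz /andP[_ zN]] //.
  have hE : h = size s by lia.
  have iy : index y s < h by rewrite hE index_mem.
  by apply: (ex _ _ iy zN); rewrite nth_index.
Unshelve. rewrite /=; lia.
Qed.

(** * The final test and the total running time *)

Definition below (j : nat) (s : seq nat) : bool := all (fun x => x \in s) (iota 0 j).

Lemma belowS j s : below j.+1 s = below j s && (j \in s).
Proof. by rewrite /below -addn1 iotaD all_cat /= andbT. Qed.

Lemma check_ok (s : seq nat) R (M : nat -> nat) :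
  static R -> (forall x, x < N -> M (tbl 0 x) = (x \in s)) ->
  ok check R M (p * 27 + 6)
    (fun R' _ => R' 0 = below (3 * p) s).
Proof.
move=> stR Mv; have N3 : 3 * p <= N by rewrite defN; nia.
pose I k (R' M' : nat -> nat) := M' = M /\ exists j,
  [/\ j + k = 3 * p, R' 5 = 1, R' 15 = k, R' 13 = tbl 0 j
    & R' 0 = below j s].
eapply ok_le; [|shelve|by move=> R' M'; apply].
eapply ok_seq; exec_blk.
eapply ok_le.
- apply: (@ok_while I _ _ _ _ _ (3 * p)) => [k {stR}R _ [-> [j [jk R5 R15 R13 R0]]] k0|].
    have jN : j < N by lia.
    apply: (@ok_seq _ _ _ _ 4 2); exec_blk.
    rewrite R13 R5 Mv //.
    apply: ok_if => [R11|R11]; last exec_blk.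
      exists k.-1; split; first by lia.
      split=> //; exists j.+1; rewrite /upd /= ?R5 ?R15 ?R13; split=> //; try lia.
        by rewrite /tbl; lia.
      rewrite belowS R0.
      by move: R11; rewrite /upd /=; case: (j \in s) => //; rewrite !andbT.
    exists k.-1; split; first by lia.
    split=> //; exists j.+1; rewrite /upd /= ?R5 ?R15 ?R13; split=> //; try lia.
      by rewrite /tbl; lia.
    rewrite belowS.
    by move: R11; rewrite /upd /=; case: (j \in s) => //; rewrite !andbF.
  case: stR => R2 R3 R4 R5 R6; split=> //; exists 0.
  by rewrite /upd /= R2 R5 R6 /tbl muln0; split=> //; lia.
- exact: leqnn.
- move=> R' M' [R15' [k [_ [j [jk _ R15 _ ->]]]]].
  by have -> : j = 3 * p by lia.
Unshelve. rewrite /=; lia.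
Qed.

Definition main : cmd := Seq setup (Seq fill (Seq search check)).

Lemma main_ok R : R 2 = 0 -> R 3 = 0 ->
  ok main R input (1000 * p ^ 3)
    (fun R' _ => exists b : bool, R' 0 = b /\ (b <-> graph_connected E)).
Proof.
move=> R2 R3; eapply ok_le; [|shelve|by move=> R' M'; apply].
eapply ok_seq; apply: ok_le (setup_ok R2 R3) (leqnn _) _ => {R2 R3}R _ [stR R9 ->].
eapply ok_seq; apply: ok_le (fill_ok stR R9) (leqnn _) _ => {stR R9}R M [stR fM].
eapply ok_seq; apply: ok_le (search_ok stR fM) (leqnn _) _ => {stR fM}R {}M [s [stR Mv sP]].
apply: ok_le (check_ok stR Mv) (leqnn _) _ => R' M' ->.
exists (below (3 * p) s); split=> //.
rewrite (connected_walk recE symE wP p_gt0) -defN; split=> [/allP H x xp|H].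
  by apply/sP/H; rewrite mem_iota.
by apply/allP => x; rewrite mem_iota => /H/sP.
Unshelve.
(* As [p >= 1], the factors are at most [38 * p] and [46 * p], and the four phases add up to less
   than [1000 * p ^ 3]. *)
have Np : N <= 3 * p ^ 2 by rewrite defN; nia.
have Np2 : N * p <= 3 * p ^ 3 by nia.
have p3 : p ^ 2 <= p ^ 3 by nia.
have p2 : p <= p ^ 2 by nia.
have : N * (p * 16 + 22) <= 38 * (3 * p ^ 3) by nia.
have : N * (p * 30 + 16) <= 46 * (3 * p ^ 3) by nia.
by lia.
Qed.

End Program.

Theorem theorem8p1 :
  exists (P : program) (C : nat),
    forall (p : nat) (A : dfa) (E : rel nat),
      symmetric E -> finite_degree E ->
      recognizes A E -> standard_one_loop A p ->
      decides_within P (encode A) (C * p ^ 3) (graph_connected E).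
Proof.
exists (compile 0 main), 1000 => p A E symE _ recE stdA.
have [w wP] := standard_walk stdA.
apply: ok_decides.
exact: (main_ok recE symE wP (standard_gt0 stdA) erefl erefl erefl).
Qed.
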